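(* Let $R$ be a unital ring and let $M$ be a right $R$-module. Suppose that (1) $M$ is projective, (2) $M$ is a semiperfect module, and (3) $M$ is a $D_3$-module. Then $M$ is a $C$-$Rad$-$D_{11}$-module.
   Context: All rings are unital and all modules are right modules. $Rad(L)$ denotes the Jacobson radical of a module $L$ (the sum of all its small submodules). A module $M$ is semiperfect if every factor module of $M$ has a projective cover. A module $M$ is a $D_3$-module if whenever $M_1$ and $M_2$ are direct summands of $M$ with $M=M_1+M_2$, then $M_1\cap M_2$ is a direct summand of $M$. For submodules $N,L$ of $M$, $L$ is a $Rad$-supplement of $N$ in $M$ if $N+L=M$ and $N\cap L\subseteq Rad(L)$. A module $M$ is a $Rad$-$D_{11}$-module if every submodule of $M$ has a $Rad$-supplement in $M$ that is a direct summand of $M$. A module $M$ is a $C$-$Rad$-$D_{11}$-module if every direct summand of $M$ is a $Rad$-$D_{11}$-module. *)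

(* Defs.v *)
From HB Require Import structures.
From mathcomp Require Import all_boot all_order all_algebra.
From mathcomp Require Import generic_quotient ring_quotient.
From mathcomp Require Import boolp classical_sets.

Set Implicit Arguments.
Unset Strict Implicit.
Unset Printing Implicit Defensive.

Import GRing.Theory.
Local Open Scope classical_set_scope.
Local Open Scope quotient_scope.
Local Open Scope ring_scope.

(* Everything is developed for left modules over an arbitrary (possibly
   noncommutative, possibly zero) ring S; right R-modules are obtained by
   taking S := R^c, the converse ring of R.

   Submodules are the library's [submodClosed M]. These are boolean predicates,
   but in the presence of the classical axioms of [boolp] this is no
   restriction: see [submod_of_set]. *)

Lemma submod_of_set (S : pzRingType) (M : lmodType S) (A : set M) :
    A 0 -> (forall (a : S) x y, A x -> A y -> A (a *: x + y)) ->
  exists N : submodClosed M, [set` N] = A.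
Proof.
move=> A0 AL.
have cA : submod_closed (fun x : M => `[< A x >]).
  split=> [|a x y]; rewrite !unfold_in /=; first exact/asboolP.
  by move=> /asboolP Ax /asboolP Ay; apply/asboolP; apply: AL.
pose B := GRing.isSubmodClosed.Build S M (fun x : M => `[< A x >])
  (GRing.submod_closed_semi cA).
pose N : submodClosed M := HB.pack (fun x : M => `[< A x >]) B.
by exists N; apply/seteqP; split=> x /= /asboolP.
Qed.

Section Submodules.
Variables (S : pzRingType) (M : lmodType S).
Implicit Types N L : submodClosed M.

Definition submod_sum N L : set M := [set x + y | x in [set` N] & y in [set` L]].

Definition submod_cap N L : {pred M} := [pred x | (x \in N) && (x \in L)].

Lemma submod_cap_closed N L : submod_closed (submod_cap N L).
Proof.
split=> [|a x y]; first by rewrite inE !rpred0.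
by rewrite !inE => /andP[Nx Lx] /andP[Ny Ly]; rewrite !rpredD ?rpredZ.
Qed.

HB.instance Definition _ N L :=
  GRing.isSubmodClosed.Build S M (submod_cap N L)
    (GRing.submod_closed_semi (submod_cap_closed N L)).

Definition submod_type N : Type := {x : M | x \in N}.

HB.instance Definition _ N := SubType.on (submod_type N).
HB.instance Definition _ N := [Choice of submod_type N by <:].
HB.instance Definition _ N := [SubChoice_isSubLmodule of submod_type N by <:].

(* [submodClosed] does not inherit from [zmodClosed], which [Quotient.quot]
   expects. *)
Definition submod_zmod N : {pred M} := [pred x | x \in N].

Lemma submod_zmod_closed N : zmod_closed (submod_zmod N).
Proof. exact: GRing.submod_closedB (submodClosedP N). Qed.

HB.instance Definition _ N :=
  GRing.isZmodClosed.Build M (submod_zmod N) (submod_zmod_closed N).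

Definition factor_module N : Type := Quotient.quot (submod_zmod N).

HB.instance Definition _ N := ZmodQuotient.on (factor_module N).

Definition factor_scale N (a : S) (u : factor_module N) : factor_module N :=
  \pi_(factor_module N) (a *: repr u).

Lemma factor_scale_pi N (a : S) (x : M) :
  factor_scale a (\pi_(factor_module N) x)
    = \pi_(factor_module N) (a *: x).
Proof.
apply/eqP; rewrite /factor_scale -(Quotient.idealrBE (submod_zmod N)) inE.
rewrite -scalerBr rpredZ //.
by rewrite -[_ \in N]/(_ \in submod_zmod N) Quotient.idealrBE reprK.
Qed.

Lemma factor_scaleA N a b (u : factor_module N) :
  factor_scale a (factor_scale b u) = factor_scale (a * b) u.
Proof.
elim/quotW: u => x.
rewrite (factor_scale_pi N b) (factor_scale_pi N a).
by rewrite (factor_scale_pi N (a * b)) scalerA.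
Qed.

Lemma factor_scale1 N : left_id 1 (@factor_scale N).
Proof. by elim/quotW=> x; rewrite factor_scale_pi scale1r. Qed.

Lemma factor_scaleDr N : right_distributive (@factor_scale N) +%R.
Proof.
move=> a; elim/quotW=> x; elim/quotW=> y.
rewrite -[\pi x + _]pi_addr (factor_scale_pi N a (x + y)) scalerDr [LHS]pi_addr.
by rewrite (factor_scale_pi N a x) (factor_scale_pi N a y).
Qed.

Lemma factor_scaleDl N (u : factor_module N) :
  {morph (@factor_scale N)^~ u : a b / a + b}.
Proof.
elim/quotW: u => x a b.
rewrite (factor_scale_pi N (a + b)) scalerDl [LHS]pi_addr.
by rewrite (factor_scale_pi N a) (factor_scale_pi N b).
Qed.

HB.instance Definition _ N :=
  GRing.Zmodule_isLmodule.Build S (factor_module N)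
    (@factor_scaleA N) (@factor_scale1 N) (@factor_scaleDr N)
    (@factor_scaleDl N).

End Submodules.

Section Kernel.
Variables (S : pzRingType) (M L : lmodType S) (f : {linear M -> L}).

Definition lkernel : {pred M} := [pred x | f x == 0].

Lemma lkernel_closed : submod_closed lkernel.
Proof.
split=> [|a x y]; first by rewrite inE linear0.
by rewrite !inE linearP => /eqP-> /eqP->; rewrite scaler0 addr0.
Qed.

HB.instance Definition _ :=
  GRing.isSubmodClosed.Build S M lkernel
    (GRing.submod_closed_semi lkernel_closed).

End Kernel.

Section ModuleNotions.
Variable S : pzRingType.
Implicit Types M P Q : lmodType S.

Definition small M (N : submodClosed M) : Prop :=
  forall X : submodClosed M, submod_sum N X = setT -> [set` X] = setT.

(* The sum of all small submodules, i.e. the set of all finite sums of elements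
   that each lie in some small submodule. *)
Definition Rad M : set M :=
  [set x | exists2 s : seq M,
     forall y, y \in s -> exists2 N : submodClosed M, small N & y \in N
     & x = \sum_(y <- s) y].
Arguments Rad : clear implicits.

Definition direct_summand M (N : submodClosed M) : Prop :=
  exists K : submodClosed M,
    submod_sum N K = setT /\ [set` submod_cap N K] = [set 0].

Definition projective P : Prop :=
  forall (A B : lmodType S) (g : {linear A -> B}) (f : {linear P -> B}),
    (forall b, exists a, g a = b) ->
    exists h : {linear P -> A}, forall x, g (h x) = f x.

Definition projective_cover P Q (p : {linear P -> Q}) : Prop :=
  [/\ projective P, (forall q, exists x, p x = q) & small (lkernel p)].

Definition semiperfect M : Prop :=
  forall N : submodClosed M,
    exists (P : lmodType S) (p : {linear P -> factor_module N}),
      projective_cover p.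

Definition D3_module M : Prop :=
  forall M1 M2 : submodClosed M,
    direct_summand M1 -> direct_summand M2 -> submod_sum M1 M2 = setT ->
    direct_summand (submod_cap M1 M2).

(* [Rad (submod_type L)] lives in the module L; [val] is the inclusion of L
   into M. *)
Definition Rad_supplement M (N L : submodClosed M) : Prop :=
  submod_sum N L = setT /\
  [set` submod_cap N L] `<=` [set val x | x in Rad (submod_type L)].

Definition Rad_D11_module M : Prop :=
  forall N : submodClosed M,
    exists2 L : submodClosed M, Rad_supplement N L & direct_summand L.

Definition C_Rad_D11_module M : Prop :=
  forall N : submodClosed M, direct_summand N -> Rad_D11_module (submod_type N).

End ModuleNotions.

Arguments Rad {S} M _.

(* Main.v *)
Require Import Defs.
From HB Require Import structures.
From mathcomp Require Import all_boot all_order all_algebra.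
From mathcomp Require Import generic_quotient ring_quotient.
From mathcomp Require Import boolp classical_sets.

(** A direct summand A of M is a retract of M. A retract of a projective module
   is projective, and an epimorphic image of a semiperfect module is
   semiperfect, because its factor modules are again factor modules of M. So
   everything reduces to [projective_semiperfect_Rad_D11]: a projective
   semiperfect module A is a Rad-D11-module.

   For that, let U be a submodule of A and p : P -> A/U a projective cover. By
   projectivity of A the canonical map A -> A/U lifts to h : A -> P, which is
   onto because ker p is small ([lift_to_cover_onto]); by projectivity of P it
   has a section s : P -> A. Then A is the direct sum of L = s(P) and ker h.
   As ker h is contained in U, A = U + L. Finally, U meets L in s(ker p), the
   image of a small submodule under P -> L, and linear maps send small
   submodules to small ones ([linear_small_Rad]), so this intersection lies in
   Rad L. *)

Set Implicit Arguments.
Unset Strict Implicit.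
Unset Printing Implicit Defensive.

Import GRing.Theory.
Local Open Scope classical_set_scope.
Local Open Scope quotient_scope.
Local Open Scope ring_scope.

Section LinearMaps.
Variable S : pzRingType.
Implicit Types M A B L P : lmodType S.

(** A name for the canonical projection, so that it can carry its linear
   structure. *)
Definition factor_proj M (N : submodClosed M) (x : M) : factor_module N :=
  \pi_(factor_module N) x.

Lemma factor_proj_linear M (N : submodClosed M) : linear (@factor_proj M N).
Proof.
move=> a x y; rewrite /factor_proj [LHS]pi_addr; congr (_ + _).
by rewrite -(factor_scale_pi N a x).
Qed.

HB.instance Definition _ M (N : submodClosed M) :=
  GRing.isLinear.Build S M (factor_module N) _ (@factor_proj M N)
    (@factor_proj_linear M N).

Lemma factor_proj_repr M (N : submodClosed M) (u : factor_module N) :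
  factor_proj N (repr u) = u.
Proof. exact: reprK. Qed.

Lemma factor_proj_eq M (N : submodClosed M) (x y : M) :
  factor_proj N x = factor_proj N y <-> x - y \in N.
Proof.
rewrite -[_ \in N]/(_ \in submod_zmod N) Quotient.idealrBE.
by split=> /eqP.
Qed.

Lemma factor_proj_eq0 M (N : submodClosed M) (x : M) :
  factor_proj N x = 0 <-> x \in N.
Proof.
by rewrite -(linear0 (factor_proj N)) factor_proj_eq subr0.
Qed.

Definition lrange M L (f : {linear M -> L}) : {pred L} :=
  [pred y | `[< exists x, f x = y >]].

Lemma lrangeP M L (f : {linear M -> L}) y :
  reflect (exists x, f x = y) (y \in lrange f).
Proof. exact: asboolP. Qed.

Lemma lrange_closed M L (f : {linear M -> L}) : submod_closed (lrange f).
Proof.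
split=> [|a _ _ /lrangeP[x <-] /lrangeP[y <-]]; apply/lrangeP.
  by exists 0; rewrite linear0.
by exists (a *: x + y); rewrite linearP.
Qed.

HB.instance Definition _ M L (f : {linear M -> L}) :=
  GRing.isSubmodClosed.Build S L (lrange f)
    (GRing.submod_closed_semi (lrange_closed f)).

Lemma submod_rpredB M (N : submodClosed M) x y :
  x \in N -> y \in N -> x - y \in N.
Proof. by have [_] := GRing.submod_closedB (submodClosedP N); apply. Qed.

Lemma submod_sumP M (N L : submodClosed M) :
  submod_sum N L = setT <->
  forall x, exists2 y, y \in N & x - y \in L.
Proof.
split=> [NL x | NL].
  have : submod_sum N L x by rewrite NL.
  by case=> y Ny [z Lz <-]; exists y => //; rewrite addrC addKr.
apply/seteqP; split=> // x _; have [y Ny Lxy] := NL x.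
by exists y => //; exists (x - y) => //; rewrite addrC subrK.
Qed.

Lemma full_submodP M (N : submodClosed M) :
  [set` N] = setT <-> forall x, x \in N.
Proof.
split=> [NT x | NT]; last by apply/seteqP; split=> x _ //; apply: NT.
by have : [set` N] x by rewrite NT.
Qed.

End LinearMaps.

Section Preimage.
Variables (S : pzRingType) (M L : lmodType S) (f : {linear M -> L}).

Definition lpreim (N : submodClosed L) : {pred M} := [pred x | f x \in N].

Lemma lpreim_closed N : submod_closed (lpreim N).
Proof.
split=> [|a x y]; first by rewrite inE linear0 rpred0.
by rewrite !inE linearP => Nx Ny; rewrite rpredD ?rpredZ.
Qed.

HB.instance Definition _ N :=
  GRing.isSubmodClosed.Build S M (lpreim N)
    (GRing.submod_closed_semi (lpreim_closed N)).

(** If f(K) + X = L, then K + f^-1(X) = M, so f^-1(X) = M by smallness of K;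
   hence X contains f(K) and X = L. The image of K is encoded as the range of
   the restriction of f to K. *)
Lemma linear_small (K : submodClosed M) :
  small K -> small (lrange (f \o (val : submod_type K -> M))).
Proof.
move=> smallK X /submod_sumP fKX; apply/full_submodP => y.
have /full_submodP fX : [set` lpreim X] = setT.
  apply: smallK; apply/submod_sumP => x.
  have [_ /lrangeP[k <-] Xxk] := fKX (f x).
  by exists (val k); [exact: valP | rewrite inE linearB].
have [_ /lrangeP[k <-] Xyk] := fKX y.
rewrite -[y](subrK (f (val k))) rpredD //.
exact: (fX (val k)).
Qed.

Lemma linear_small_Rad (K : submodClosed M) x :
  small K -> x \in K -> Rad L (f x).
Proof.
move=> smallK Kx; exists [:: f x]; last by rewrite big_seq1.
move=> _ /[1!inE] /eqP->; eexists; first exact: linear_small smallK.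
by apply/lrangeP; exists (Sub x Kx).
Qed.

End Preimage.

Section Semiperfect.
Variable S : pzRingType.
Implicit Types M A B L P Q : lmodType S.

(** If K complements N, each x has a component y in N with x - y in K. The
   trivial intersection makes y unique, so the chosen component is linear in x
   and is x itself when x lies in N. *)
Lemma direct_summand_retraction M (N : submodClosed M) :
  direct_summand N ->
  exists q : {linear M -> submod_type N}, forall x, q (val x) = x.
Proof.
case=> K [/submod_sumP sumNK capNK].
have ex_q x : exists y : submod_type N, x - val y \in K.
  by have [y Ny Kxy] := sumNK x; exists (Sub y Ny); rewrite SubK.
have [q qK] := choice ex_q.
have q_uniq x (y : submod_type N) : x - val y \in K -> q x = y.
  move=> Kxy; apply/val_inj/eqP; rewrite -subr_eq0; apply/eqP.
  have Nqy : val (q x) - val y \in N.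
    by apply: submod_rpredB; [exact: (valP (q x)) | exact: (valP y)].
  have Kqy : val (q x) - val y \in K.
    by rewrite -[val (q x)](subKr x) addrAC; apply: submod_rpredB.
  suff : [set` submod_cap N K] (val (q x) - val y) by rewrite capNK.
  by apply/andP; split.
have q_lin : linear q.
  move=> a x y; apply: q_uniq.
  rewrite (linearP (val : submod_type N -> M)) opprD addrACA -scalerBr.
  by rewrite rpredD ?rpredZ.
pose qB := GRing.isLinear.Build S M (submod_type N) _ q q_lin.
exists (HB.pack q qB : {linear M -> submod_type N}) => x /=.
by apply: q_uniq; rewrite subrr rpred0.
Qed.

Lemma projective_retract M A (i : {linear A -> M}) (q : {linear M -> A}) :
  (forall x, q (i x) = x) -> projective M -> projective A.
Proof.
move=> iK projM B C g f g_onto.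
have [h gh] := projM B C g (f \o q) g_onto.
by exists (h \o i) => x; rewrite /= gh /= iK.
Qed.

(** The first isomorphism theorem identifies A/U with M/V, where V is the
   preimage of U, and a projective cover of M/V is carried along. *)
Lemma semiperfect_epi M A (q : {linear M -> A}) :
  (forall x, exists m, q m = x) -> semiperfect M -> semiperfect A.
Proof.
move=> q_onto semiM U; have [P [p [projP p_onto smallp]]] := semiM (lpreim q U).
have fE m m' : factor_proj U (q m) = factor_proj U (q m') <->
               factor_proj (lpreim q U) m = factor_proj (lpreim q U) m'.
  by rewrite !factor_proj_eq inE linearB.
pose r y := factor_proj U (q (repr (p y))).
have r_lin : linear r.
  move=> a x y; rewrite /r -!linearP; apply/fE.
  rewrite factor_proj_repr linearP.
  by rewrite [RHS](linearP (factor_proj (lpreim q U))) /= !factor_proj_repr.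
pose rB := GRing.isLinear.Build S P (factor_module U) _ r r_lin.
pose rl : {linear P -> factor_module U} := HB.pack r rB.
exists P, rl; split=> //.
  move=> u; have [m qm] := q_onto (repr u).
  have [y py] := p_onto (factor_proj (lpreim q U) m); exists y.
  rewrite -[u]factor_proj_repr -qm; apply/fE.
  by rewrite factor_proj_repr.
have kerE y : (y \in lkernel rl) = (y \in lkernel p).
  apply/eqP/eqP => [|py0].
    rewrite /= /r => /factor_proj_eq0 Uq.
    by rewrite -[p y]factor_proj_repr; apply/factor_proj_eq0.
  by apply/factor_proj_eq0/(factor_proj_eq0 (lpreim q U)); rewrite factor_proj_repr.
move=> X /submod_sumP sumX; apply: smallp; apply/submod_sumP => x.
by have [y ry0 Xxy] := sumX x; exists y => //; rewrite -kerE.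
Qed.

(** The range of h and the small submodule ker p together span P. *)
Lemma lift_to_cover_onto A P Q (p : {linear P -> Q}) (h : {linear A -> P}) :
  small (lkernel p) -> (forall z, exists x, p (h x) = z) ->
  forall y, exists x, h x = y.
Proof.
move=> smallp ph_onto y.
suff /full_submodP hT : [set` lrange h] = setT by exact/lrangeP.
apply: smallp; apply/submod_sumP => {}y; have [x px] := ph_onto (p y).
exists (y - h x); first by rewrite inE linearB px subrr.
by rewrite subKr; apply/lrangeP; exists x.
Qed.

Lemma lrange_direct_summand A P (h : {linear A -> P}) (s : {linear P -> A}) :
  (forall y, h (s y) = y) -> direct_summand (lrange s).
Proof.
move=> sK; pose kerh : submodClosed A := lkernel h; exists kerh; split.
  apply/submod_sumP => x; exists (s (h x)); first by apply/lrangeP; exists (h x).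
  by rewrite inE linearB sK subrr.
apply/seteqP; split=> [_ /andP[/lrangeP[y <-]]|_ ->] /=; last by rewrite rpred0.
by rewrite inE sK => /eqP->; rewrite linear0.
Qed.

Lemma projective_semiperfect_Rad_D11 A :
  projective A -> semiperfect A -> Rad_D11_module A.
Proof.
move=> projA semiA U; have [P [p [projP p_onto smallp]]] := semiA U.
have [h ph] := projA _ _ p (factor_proj U) p_onto.
have h_onto : forall y, exists x, h x = y.
  apply: (lift_to_cover_onto (p := p)) => // u.
  by exists (repr u); rewrite ph /= factor_proj_repr.
have [s hs] := projP _ _ h idfun h_onto.
eexists; last exact: lrange_direct_summand hs.
split.
  (* The part x - s (h x) of x lies in ker h, hence in U. *)
  apply/submod_sumP => x; exists (x - s (h x)).
    by apply/factor_proj_eq0; rewrite -ph linearB hs subrr linear0.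
  by rewrite subKr; apply/lrangeP; exists (h x).
move=> x /andP[Ux /lrangeP[y yx]].
have s_in z : s z \in lrange s by apply/lrangeP; exists z.
pose t z : submod_type (lrange s) := Sub (s z) (s_in z).
have t_lin : linear t by move=> a u v; apply: val_inj; rewrite linearP !SubK linearP.
pose tB := GRing.isLinear.Build S P (submod_type (lrange s)) _ t t_lin.
pose tl : {linear P -> submod_type (lrange s)} := HB.pack t tB.
exists (tl y) => //.
(* As x = s y lies in U, p y = p (h (s y)) is the class of x, which is zero. *)
apply: (linear_small_Rad tl smallp).
by rewrite inE -[y]hs ph yx; apply/eqP/factor_proj_eq0.
Qed.

End Semiperfect.

Theorem theorem2p10 (R : pzRingType) (M : lmodType R^c) :
  projective M -> semiperfect M -> D3_module M -> C_Rad_D11_module M.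
Proof.
move=> projM semiM _ N /direct_summand_retraction[q qK].
apply: projective_semiperfect_Rad_D11.
  exact: (projective_retract (i := val) qK projM).
by apply: semiperfect_epi semiM => x; exists (val x); apply: qK.
Qed.
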